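(* Let $X$ be a Cantor set. (1) The set $\mathcal{P}er_0$ of all $P\in Homeo(X)$ such that $P^n=\mathrm{id}_X$ for some integer $n\ge 1$ is $\tau$-dense in $Homeo(X)$. (2) Let $T\in Homeo(X)$. Then for any automorphism $S\in [T]_B$ and any $\tau$-neighborhood $U=U(S;\mu_1,\ldots,\mu_p;\varepsilon)$ of $S$ (where $\mu_1,\ldots,\mu_p$ are Borel probability measures on $X$ and $\varepsilon>0$) there exists a periodic homeomorphism $P\in[[T]]$ such that $P\in U$.
   Context: $X$ is a Cantor set and $\mathcal B$ its $\sigma$-algebra of Borel sets. $Aut(X,\mathcal B)$ is the group of all Borel bijections of $X$ onto itself (automorphisms), and $Homeo(X)$ is its subgroup of all homeomorphisms of $X$. For $S,T\in Aut(X,\mathcal B)$ put $E(S,T)=\{x\in X: Sx\ne Tx\}$. The uniform topology $\tau$ on $Aut(X,\mathcal B)$ has as a base the sets $$U(T;\mu_1,\ldots,\mu_n;\varepsilon)=\{S\in Aut(X,\mathcal B):\mu_i(E(S,T))<\varepsilon,\ i=1,\ldots,n\},$$ where $T\in Aut(X,\mathcal B)$, $\mu_1,\ldots,\mu_n$ are Borel probability measures on $X$, and $\varepsilon>0$. The induced topology on $Homeo(X)$ is also denoted $\tau$. For $T\in Aut(X,\mathcal B)$ let $Orb_T(x)=\{T^nx:n\in\mathbb Z\}$. For $T\in Homeo(X)$: $[T]_B=\{S\in Aut(X,\mathcal B): Orb_S(x)\subseteq Orb_T(x)\text{ for all }x\in X\}$ and $[T]_C=[T]_B\cap Homeo(X)$.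 The topological full group $[[T]]$ is the group of all $S\in[T]_C$ for which there is a continuous function $n_S:X\to\mathbb Z$ with $Sx=T^{n_S(x)}x$ for all $x\in X$. A periodic homeomorphism is one with $P^n=\mathrm{id}_X$ for some integer $n\ge1$, i.e. an element of $\mathcal{P}er_0$. *)

(* Defs.v *)
From HB Require Import structures.
From mathcomp Require Import all_boot all_order all_algebra.
From mathcomp Require Import finmap.
From mathcomp Require Import all_classical all_reals all_analysis.
From mathcomp Require Import lra.

Set Implicit Arguments.
Unset Strict Implicit.
Unset Printing Implicit Defensive.

Import Order.TTheory GRing.Theory Num.Theory.
Import numFieldNormedType.Exports.

Local Open Scope classical_set_scope.
Local Open Scope ring_scope.

Definition borel (X : ptopologicalType) := g_sigma_algebraType (@open X).

HB.instance Definition _ (X : ptopologicalType) := Measurable.on (borel X).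

(* The inverse is stored as data because orbits need it. It is determined by
   [aut_fun], and it is Borel too when X is a Cantor set (Lusin-Souslin). *)
Record borel_aut (X : ptopologicalType) := Aut {
  aut_fun :> X -> X;
  aut_inv : X -> X;
  aut_funK : cancel aut_fun aut_inv;
  aut_invK : cancel aut_inv aut_fun;
  measurable_aut : measurable_fun setT (aut_fun : borel X -> borel X) }.

HB.instance Definition _ (X : ptopologicalType) := gen_eqMixin (borel_aut X).
HB.instance Definition _ (X : ptopologicalType) := gen_choiceMixin (borel_aut X).

Section aut_topology.
Context {R : realType} {X : pseudoPMetricType R}.
Implicit Types (S T : borel_aut X).

Definition diff_set S T : set X := [set x | S x <> T x].

Definition aut_nbhs T (n : nat) (mu : 'I_n -> probability (borel X) R)
    (eps : R) : set (borel_aut X) :=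
  [set S | forall i, (mu i (diff_set S T) < eps%:E)%E].

Definition aut_base : set (set (borel_aut X)) :=
  [set U | exists T n (mu : 'I_n -> probability (borel X) R) (eps : R),
     0 < eps /\ U = aut_nbhs T mu eps].

(* The topology generated by [aut_base]; [aut_base_basis] below shows
   that [aut_base] is a base of it, and not only a subbase, when X is a
   Cantor set. *)
HB.instance Definition _ := isSubBaseTopological.Build (borel_aut X) aut_base id.

Definition homeo : set (borel_aut X) :=
  [set T : borel_aut X | continuous (T : X -> X) /\ continuous (aut_inv T)].

Definition per0 : set (borel_aut X) :=
  [set P : borel_aut X | homeo P /\
     exists2 n : nat, (1 <= n)%N & forall x, iter n (P : X -> X) x = x].

Definition aut_pow T (k : int) : X -> X :=
  match k with
  | Posz n => iter n T
  | Negz n => iter n.+1 (aut_inv T)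
  end.

Definition aut_orbit T (x : X) : set X := range (fun k : int => aut_pow T k x).

Definition full_groupB T : set (borel_aut X) :=
  [set S | forall x, aut_orbit S x `<=` aut_orbit T x].

Definition full_groupC T : set (borel_aut X) := full_groupB T `&` homeo.

Definition top_full_group T : set (borel_aut X) :=
  [set S | full_groupC T S /\
     exists2 n : X -> discrete_topology int,
       continuous n & forall x, S x = aut_pow T (n x) x].

End aut_topology.

Section aut_base_basis.
Context {R : realType} {X : pseudoPMetricType R}.
Hypothesis cX : cantor_like X.
Implicit Types (S T : borel_aut X).

Lemma measurable_diff_set S T :
  measurable (diff_set S T : set (borel X)).
Proof.
have [_ cptX _ zX] := cX.
pose U := unsquash (clopen_surj cptX).
have mU n : measurable (U n : set (borel X)).
  by apply: sub_sigma_algebra; have [] : clopen (U n) by exact: funS.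
have -> : diff_set S T = \bigcup_n (S @^-1` (U n) `&` ~` (T @^-1` (U n))).
  apply/seteqP; split=> x /=.
    move=> /eqP/zX[A [clA ASx nATx]].
    have [n _ UnA] := @surj _ _ _ _ U _ clA.
    by exists n => //; rewrite /= UnA.
  by move=> [n _ [/= US UT]] ST; apply: UT; rewrite -ST.
apply: bigcup_measurable => n _; apply: measurableI.
  by rewrite -[X in measurable X]setTI; exact: (measurable_aut S _ (mU n)).
apply: measurableC.
by rewrite -[X in measurable X]setTI; exact: (measurable_aut T _ (mU n)).
Qed.

Lemma diff_set_lt (mu : probability (borel X) R) S T S' (a b : R) :
  (mu (diff_set S T) < a%:E)%E -> (mu (diff_set S' S) < b%:E)%E ->
  (mu (diff_set S' T) < (a + b)%:E)%E.
Proof.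
move=> ha hb; apply: (@le_lt_trans _ _
    (mu (diff_set S T) + mu (diff_set S' S))%E); last first.
  by rewrite EFinD lteD.
apply: le_trans (measureU2 _ _ _); try exact: measurable_diff_set.
apply: le_measure; rewrite ?inE; try exact: measurable_diff_set.
  by apply: measurableU; exact: measurable_diff_set.
move=> x /= S'T; have [SS'|/eqP SS'] := eqVneq (S' x) (S x); last by right.
by left => /= ST; apply: S'T; rewrite SS'.
Qed.

Lemma aut_nbhs_open S T n (mu : 'I_n -> probability (borel X) R) eps :
  aut_nbhs T mu eps S ->
  exists2 d, 0 < d & aut_nbhs S mu d `<=` aut_nbhs T mu eps.
Proof.
move=> ST.
have fd i : exists2 d : R, 0 < d & (mu i (diff_set S T) < (eps - d)%:E)%E.
  have muf : mu i (diff_set S T) \is a fin_num.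
    by apply: fin_num_measure; exact: measurable_diff_set.
  have := ST i; rewrite -(fineK muf) lte_fin => h.
  by exists ((eps - fine (mu i (diff_set S T))) / 2);
    rewrite ?lte_fin; lra.
pose f i := sval (cid2 (fd i)).
have f0 i : 0 < f i by rewrite /f; case: cid2.
have fP i : (mu i (diff_set S T) < (eps - f i)%:E)%E by rewrite /f; case: cid2.
exists (\big[Order.min/1]_i f i).
  by elim/big_ind : _ => // x y x0 y0; rewrite lt_min x0 y0.
move=> S' hS' i /=.
rewrite -[eps](subrK (f i)); apply: diff_set_lt (fP i) _.
by apply: lt_le_trans (hS' i) _; rewrite lee_fin; exact: bigmin_le_cond.
Qed.

Lemma aut_base_filter S :
  Filter (filter_from [set U | aut_base U /\ U S] id).
Proof.
apply: filter_from_filter.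
  exists setT; split=> //.
  exists S, 0, (fun i : 'I_0 => match notF (valP i) with end), 1.
  split=> //.
  by apply/seteqP; split=> // S' _ [].
move=> _ _ [[T [n [mu [e [e0 ->]]]]] ST] [[T' [n' [mu' [e' [e'0 ->]]]]] ST'].
have [d d0 dT] := aut_nbhs_open ST.
have [d' d'0 dT'] := aut_nbhs_open ST'.
pose nu (i : 'I_(n + n')) :=
  match fintype.split i with inl j => mu j | inr j => mu' j end.
exists (aut_nbhs S nu (Order.min d d')); first split.
- by exists S, (n + n')%N, nu, (Order.min d d'); rewrite lt_min d0 d'0.
- move=> i; have -> : diff_set S S = set0.
    by apply/seteqP; split=> // x /= /(_ erefl).
  by rewrite measure0 lte_fin lt_min d0 d'0.
- move=> S' hS'; split; [apply: dT => i|apply: dT' => i].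
    have := hS' (lshift n' i); rewrite /nu (unsplitK (inl i)) => h.
    by apply: lt_le_trans h _; rewrite lee_fin ge_min lexx.
  have := hS' (rshift n i); rewrite /nu (unsplitK (inr i)) => h.
  by apply: lt_le_trans h _; rewrite lee_fin ge_min lexx orbT.
Qed.

Lemma aut_base_basis : basis (@aut_base R X).
Proof.
split=> [U bU|S A].
  exists [set U]; last exact: bigcup_set1.
  move=> _ ->; exists [fset U]%fset.
    by move=> V; rewrite in_fset1 => /eqP ->; exact: mem_set.
  by rewrite set_fset1 bigcap_set1.
rewrite nbhsE => -[_ [[B sB <-] [C BC CS]] sBA].
have ? := aut_base_filter S.
apply: filterS sBA _; apply: (@filterS _ _ _ C) => [x Cx|]; first by exists C.
have /sB[D sD IDeC] := BC; rewrite -IDeC; apply: filter_bigI => E DE.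
exists E => //; split; first by have /sD := DE; rewrite inE.
by move: CS; rewrite -IDeC => /(_ _ DE).
Qed.

End aut_base_basis.

(* Main.v *)
Require Import Defs.
From HB Require Import structures.
From mathcomp Require Import all_boot all_order all_algebra.
From mathcomp Require Import all_classical all_reals all_analysis.
From mathcomp Require Import zify lra.

(** Let [S] belong to the Borel full group of a homeomorphism [T]. The proof has
    a Borel part and a topological part.

    Borel part ([exists_cut]). The map [S] can be modified on a set of small
    measure so that almost all of its orbits become cycles of bounded length. A
    set [D] of markers ([exists_marker]) cuts the [S]-orbits into segments of
    bounded length, and the last point of a segment is sent back to the first
    one. Modifying [S] on [D] is harmless: either the [S]-orbit is a short cycle
    with a single marker, and nothing changes, or the marker belongs to one of
    many disjoint translates of the same set, and the translate used has small
    measure. The modified map is a hop [x |-> T^(n x) x] with [n] Borel, and [n]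
    is chosen so that its sum over each cycle is zero.

    Topological part ([exists_periodic_full_group]). The function [n] agrees with
    a continuous integer function [m] off a set of small measure
    ([open_fibers_approximation]). The hop [Q x = T^(m x) x] is continuous but
    perhaps not bijective. Let [M] be a common multiple of the cycle lengths and
    let [G] be the set where the sum of [m] over [M] successive points of the
    [Q]-orbit is zero. Then [G] is clopen, [Q^M] is the identity on [G], and
    hence [Q] maps [G] into itself with the same sum. So the map [P] equal to [Q]
    on [G] and to the identity elsewhere is a periodic homeomorphism in the
    topological full group of [T]. If a point is good for the Borel part and the
    first [M] points of its orbit under the hop by [n] avoid the set where [m]
    and [n] differ, then the two orbits agree there, the point is in [G], and
    [P] and [S] agree at it. The exceptional set is small because the error in
    approximating [n] is controlled for the sum of the images of the measures
    under the first [M] iterates.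

    Density of the periodic homeomorphisms is the case [S = T], because a
    neighborhood of a homeomorphism contains a basic one centered at it. *)

Set Implicit Arguments.
Unset Strict Implicit.
Unset Printing Implicit Defensive.

Import Order.TTheory GRing.Theory Num.Theory.
Import numFieldNormedType.Exports.

Local Open Scope classical_set_scope.
Local Open Scope ring_scope.

(** * Measurable functions into countable types *)

Lemma preimage_glue (Y Z C : Type) (f : Y -> C) (F : C -> Y -> Z) (B : set Z) :
  (fun x => F (f x) x) @^-1` B = \bigcup_c (f @^-1` [set c] `&` F c @^-1` B).
Proof.
by apply/seteqP; split=> [x /= Bx|x [c _ [/= -> //]]]; exists (f x).
Qed.

Section measurable_fibers.
Context d (Y : measurableType d).

(** A function into a countable type all of whose fibers are measurable; this is
    measurability for the discrete sigma-algebra on the target, which is not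
    required to carry a measurable structure. *)
Definition measurable_fibers (C : Type) (f : Y -> C) :=
  forall c, measurable (f @^-1` [set c]).

Lemma measurable_preimage_glue (C : countType) (Z : Type)
    (f : Y -> C) (F : C -> Y -> Z) (B : set Z) :
  measurable_fibers f -> (forall c, measurable (F c @^-1` B)) ->
  measurable ((fun x => F (f x) x) @^-1` B).
Proof.
move=> mf mF; rewrite preimage_glue; apply: countable_bigcupT_measurable => //.
by move=> c; apply: measurableI.
Qed.

Lemma measurable_fibersP (C : countType) (f : Y -> C) (B : set C) :
  measurable_fibers f -> measurable (f @^-1` B).
Proof.
move=> mf; apply: (measurable_preimage_glue (F := fun c _ => c)) => // c.
have [Bc|nBc] := pselect (B c).
  by rewrite (_ : _ @^-1` _ = setT)//; apply/seteqP; split.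
by rewrite (_ : _ @^-1` _ = set0)//; apply/seteqP; split.
Qed.

Lemma measurable_fibers_cst (C : eqType) (c : C) :
  measurable_fibers (fun=> c).
Proof.
move=> c'; have [->|cc'] := eqVneq c c'.
  by rewrite (_ : _ @^-1` _ = setT)//; apply/seteqP; split.
rewrite (_ : _ @^-1` _ = set0)//; apply/seteqP; split=> // x /= h.
by rewrite h eqxx in cc'.
Qed.

Lemma measurable_fibers_comp (f : Y -> Y) (C : Type) (g : Y -> C) :
  measurable_fun setT f -> measurable_fibers g -> measurable_fibers (g \o f).
Proof.
by move=> mf mg c; rewrite comp_preimage -[X in measurable X]setTI; exact: mf.
Qed.

Lemma measurable_fibers_if (D : set Y) (C : Type) (g h : Y -> C) :
  measurable D -> measurable_fibers g -> measurable_fibers h ->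
  measurable_fibers (fun x => if `[< D x >] then g x else h x).
Proof.
move=> mD mg mh c.
rewrite (_ : _ @^-1` _ =
  (D `&` g @^-1` [set c]) `|` (~` D `&` h @^-1` [set c])).
  by apply: measurableU; apply: measurableI => //; exact: measurableC.
apply/seteqP; split=> x /=.
  by case: asboolP => Dx; [left|right].
by case: asboolP => Dx; case=> -[].
Qed.

Lemma measurable_fibers_op (C : countType) (op : C -> C -> C) (f g : Y -> C) :
  measurable_fibers f -> measurable_fibers g ->
  measurable_fibers (fun x => op (f x) (g x)).
Proof.
move=> mf mg c.
apply: (measurable_preimage_glue (F := fun v x => op v (g x))) => // v.
exact: (measurable_fibersP [set w | op v w = c]).
Qed.

Lemma measurable_fun_glue (C : countType) (f : Y -> C) (F : C -> Y -> Y) :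
  measurable_fibers f -> (forall c, measurable_fun setT (F c)) ->
  measurable_fun setT (fun x => F (f x) x).
Proof.
move=> mf mF _ B mB; rewrite setTI; apply: measurable_preimage_glue => // c.
by rewrite -[X in measurable X]setTI; exact: mF.
Qed.

Lemma measurable_fun_iter (f : Y -> Y) n :
  measurable_fun setT f -> measurable_fun setT (iter n f).
Proof.
by move=> mf; elim: n => [|n IHn]; [exact: measurable_id|exact: measurableT_comp].
Qed.

Lemma measurable_preimage (f : Y -> Y) (B : set Y) :
  measurable_fun setT f -> measurable B -> measurable (f @^-1` B).
Proof. by move=> mf mB; rewrite -[X in measurable X]setTI; exact: mf. Qed.

(** If every [x] satisfies one of countably many measurable conditions [P c],
    the choice of such a [c] can be made measurably: take the first one in the
    enumeration of [C]. *)
Lemma measurable_choice (C : countType) (P : C -> set Y) :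
  (forall c, measurable (P c)) -> (forall x, exists c, P c x) ->
  exists2 f : Y -> C, measurable_fibers f & forall x, P (f x) x.
Proof.
move=> mP exP.
pose Q n : set Y := [set x | exists2 c, pickle_inv n = Some c & P c x].
have mQ n : measurable (Q n).
  rewrite /Q; case: (pickle_inv n) => [c|].
    rewrite (_ : mkset _ = P c)//.
    by apply/seteqP; split=> [x [_ [<-]]|x Px]//; exists c.
  by rewrite (_ : mkset _ = set0)//; apply/seteqP; split=> // x [].
have exQ x : exists n, `[< Q n x >].
  have [c Pc] := exP x; exists (pickle c); apply/asboolP.
  by exists c => //; exact: pickleK_inv.
pose r x := ex_minn (exQ x).
have rQ x : Q (r x) x by rewrite /r; case: ex_minnP => n /asboolP.
have rmin x n : Q n x -> (r x <= n)%N.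
  by move=> Qn; rewrite /r; case: ex_minnP => k _; apply; exact/asboolP.
pose f x := s2val (cid2 (rQ x)).
have fr x : pickle (f x) = r x.
  rewrite /f; case: cid2 => c /= rc _.
  by have := pickle_invK (T := C) (r x); rewrite rc.
exists f => [c|x]; last by rewrite /f; case: cid2.
rewrite (_ : _ @^-1` _ =
    Q (pickle c) `&` \bigcap_(n in [set n | (n < pickle c)%N]) ~` Q n).
  apply: measurableI => //; apply: fin_bigcap_measurable.
    exact: finite_II.
  by move=> n _; exact: measurableC.
apply/seteqP; split=> x /=.
  move=> <-; rewrite fr; split=> // n /= nr /rmin.
  by rewrite leqNgt nr.
move=> [Qc ltQ]; apply: (pcan_inj pickleK_inv).
rewrite fr; apply/eqP; rewrite eqn_leq rmin//= leqNgt; apply/negP => rc.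
exact: ltQ (rQ x).
Qed.

(** Two points where [f] and [g] differ are told apart by some [U n], so the set
    where they differ is a countable union of measurable sets. *)
Lemma measurable_equalizer (U : nat -> set Y) (f g : Y -> Y) :
  (forall n, measurable (U n)) ->
  (forall x y, x <> y -> exists2 n, U n x & ~ U n y) ->
  measurable_fun setT f -> measurable_fun setT g ->
  measurable [set x | f x = g x].
Proof.
move=> mU sepU mf mg.
rewrite -[X in measurable X]setCK; apply: measurableC.
rewrite (_ : ~` _ = \bigcup_n (f @^-1` U n `&` g @^-1` (~` U n))).
  apply: bigcup_measurable => n _.
  by apply: measurableI; apply: measurable_preimage => //; exact: measurableC.
apply/seteqP; split=> [x /= /sepU[n Uf Ug]|x [n _ [/= Uf Ug]] fg].
  by exists n.
by apply: Ug; rewrite -fg.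
Qed.

End measurable_fibers.

(** * Finite measures *)

Section finite_measures.
Context d (Y : measurableType d) (R : realType).
Implicit Types nu : {finite_measure set Y -> \bar R}.

Lemma finite_measure_setU_lt nu (A B : set Y) (a b : R) :
  measurable A -> measurable B ->
  (nu A < a%:E)%E -> (nu B < b%:E)%E -> (nu (A `|` B) < (a + b)%:E)%E.
Proof.
move=> mA mB Aa Bb; apply: le_lt_trans (measureU2 nu mA mB) _.
by rewrite EFinD lteD.
Qed.

Lemma finite_measure_bigcup_lt nu (A : nat -> set Y) n (e : R) :
  (forall m, measurable (A m)) -> 0 < e ->
  (forall m, (m < n)%N -> (nu (A m) < (e / n.+1%:R)%:E)%E) ->
  (nu (\bigcup_(m in [set m | (m < n)%N]) A m) < e%:E)%E.
Proof.
move=> mA e0 Ae.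
have H k : (k <= n)%N ->
    (nu (\bigcup_(m in [set m | (m < k)%N]) A m)
      < (k.+1%:R * (e / n.+1%:R))%:E)%E.
  elim: k => [_|k IHk kn].
    rewrite (_ : [set m | _] = set0); last by apply/seteqP; split.
    by rewrite bigcup_set0 measure0 mul1r lte_fin divr_gt0.
  rewrite (_ : bigcup _ _ = \bigcup_(m in [set m | (m < k)%N]) A m `|` A k).
    rewrite -[k.+2%:R]natr1 mulrDl mul1r; apply: finite_measure_setU_lt => //.
    - exact: bigcup_measurable.
    - by apply: IHk; exact: ltnW.
    - exact: Ae.
  apply/seteqP; split=> x.
    move=> [m /=]; rewrite ltnS leq_eqVlt => /orP[/eqP -> ?|mk ?].
      by right.
    by left; exists m.
  by case=> [[m /= mk]|] Am; [exists m => //=; lia|exists k => /=].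
by have := H n (leqnn _); rewrite mulrCA divff ?mulr1// pnatr_eq0.
Qed.

(** The part of a countable union missed by the first [N] terms decreases to the
    empty set, so its measure tends to zero. *)
Lemma finite_measure_tail nu (B : nat -> set Y) (e : R) :
  (forall n, measurable (B n)) -> 0 < e ->
  exists N, (nu (\bigcup_n B n `\` \bigcup_(m in [set m | (m < N)%N]) B m)
               < e%:E)%E.
Proof.
move=> mB e0.
pose C N := \bigcup_n B n `\` \bigcup_(m in [set m | (m < N)%N]) B m.
have mC N : measurable (C N).
  by apply: measurableD; exact: bigcup_measurable.
have C0 : \bigcap_N C N = set0.
  apply/seteqP; split=> // x Cx; have [[n _ Bn] _] := Cx 0%N I.
  by have [_] := Cx n.+1 I; apply; exists n => /=.
have : nu \o C @ \oo --> nu (\bigcap_N C N).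
  apply: nonincreasing_cvg_mu => //.
  - by rewrite ltey_eq fin_num_measure.
  - by apply: bigcapT_measurable.
  - move=> m n mn; apply/subsetPset => x [Bx nBx]; split=> // -[k /= km Bk].
    by apply: nBx; exists k => //=; apply: leq_trans mn.
rewrite C0 measure0 => /fine_cvgP[_ /cvgrPdist_lt/(_ _ e0)[N _ /(_ N (leqnn _))]].
rewrite /= sub0r normrN ger0_norm ?fine_ge0// => h.
exists N; rewrite -/(C N) -[nu (C N)]fineK ?lte_fin//.
by rewrite fin_num_measure.
Qed.

(** Among [L] pairwise disjoint sets, one carries at most a fraction [1 / L] of
    the total mass. *)
Lemma finite_measure_pigeonhole nu (A : nat -> set Y) L (e : R) :
  (forall n, measurable (A n)) ->
  (forall i j x, (i < j < L)%N -> A i x -> A j x -> False) ->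
  (nu setT < (L%:R * e)%:E)%E -> exists2 c, (c < L)%N & (nu (A c) < e%:E)%E.
Proof.
move=> mA dA nuL; apply: contrapT => nA.
move: nuL; rewrite ltNge => /negP; apply.
have -> : (L%:R * e)%:E = (\sum_(i < L) e%:E)%E.
  by rewrite sumEFin sumr_const card_ord mulr_natl.
apply: (@le_trans _ _ (\sum_(i < L) nu (A i))%E).
  apply: lee_sum => i _; rewrite leNgt; apply/negP => h.
  by apply: nA; exists i.
rewrite -(@measure_bigsetU_ord _ _ _ nu _ xpredT (fun i => A i))//; last first.
  apply/trivIsetP => i j _ _ ij; apply/seteqP; split=> // x [Ai Aj].
  case: (ltngtP i j) => h.
  - by apply: (dA i j x _ Ai Aj); rewrite h ltn_ord.
  - by apply: (dA j i x _ Aj Ai); rewrite h ltn_ord.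
  - by move/eqP: ij; apply; exact: val_inj.
by apply: le_measure; rewrite ?inE//; exact: bigsetU_measurable.
Qed.

Lemma finite_measure_of_fin_num (m : {measure set Y -> \bar R}) : fin_num_fun m ->
  exists nu : {finite_measure set Y -> \bar R}, forall A, nu A = m A.
Proof.
move=> fin.
pose H1 := isFinite.Build _ _ _ _ fin.
have sigf : sigma_finite setT m.
  by apply: fin_num_fun_sigma_finite => //; rewrite measure0.
pose H2 := isSFinite.Build _ _ _ _ (sfinite_measure_sigma_finite sigf).
pose H3 := isSigmaFinite.Build _ _ _ _ sigf.
by exists (HB.pack_for (FiniteMeasure.type Y R) (Measure.sort m) H1 H2 H3).
Qed.

Lemma finite_measure_pushforward nu (f : Y -> Y) :
  measurable_fun setT f ->
  exists nu' : {finite_measure set Y -> \bar R},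
    forall A, nu' A = nu (f @^-1` A).
Proof.
move=> mf.
have [m mE] : exists m : {measure set Y -> \bar R},
    forall A, m A = nu (f @^-1` A).
  by unshelve eexists (pushforward nu f : {measure set Y -> \bar R}).
have [A mA|nu' nu'E] := finite_measure_of_fin_num (m := m).
  by rewrite mE; apply: fin_num_measure; exact: measurable_preimage.
by exists nu' => A; rewrite nu'E.
Qed.

Lemma finite_measure_sum n (mu : 'I_n -> {finite_measure set Y -> \bar R}) :
  exists nu : {finite_measure set Y -> \bar R},
    forall A, nu A = (\sum_(i < n) mu i A)%E.
Proof.
pose m k : {measure set Y -> \bar R} :=
  if insub k is Some i then (mu i : {measure set Y -> \bar R}) else mzero.
have mE A : msum m n A = (\sum_(i < n) mu i A)%E.
  by apply: eq_bigr => i _; rewrite /m valK.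
have fin : fin_num_fun (msum m n).
  by move=> A mA; rewrite mE; apply/sum_fin_numP => i _ _; exact: fin_num_measure.
by have [nu nuE] := finite_measure_of_fin_num fin; exists nu => A; rewrite nuE -mE.
Qed.

End finite_measures.

(** * Markers for a measurable action of the integers *)

Lemma separating_sequence_points (Y : Type) (U : nat -> set Y) :
  (forall x n (g : nat -> Y), exists2 m, U m x &
    forall i, (i < n)%N -> g i <> x -> ~ U m (g i)) ->
  forall x y, x <> y -> exists2 n, U n x & ~ U n y.
Proof.
move=> sepU x y xy; have [n Ux nU] := sepU x 1 (fun=> y).
by exists n => //; apply: (nU 0%N) => // /esym.
Qed.

Section markers.
Context d (Y : measurableType d) (R : realType).
(** [a] is a measurable action of the additive group of integers, and [U] is a
    sequence of measurable sets that isolates every point from any finite number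
    of other points. *)
Variables (a : int -> Y -> Y) (U : nat -> set Y).
Hypothesis a0 : forall x, a 0 x = x.
Hypothesis aD : forall i j x, a (i + j) x = a i (a j x).
Hypothesis ma : forall i, measurable_fun setT (a i).
Hypothesis mU : forall n, measurable (U n).
Hypothesis sepU : forall x n (g : nat -> Y), exists2 m, U m x &
  forall i, (i < n)%N -> g i <> x -> ~ U m (g i).

Let sepU1 := separating_sequence_points sepU.

(** The points of [U n] that do not come back to [U n] in less than [L] steps, unless
    they come back to themselves. For fixed [L] these sets cover the space. *)
Let locally_free L n : set Y := U n `&`
  \bigcap_(i in [set i | (i < L)%N])
    (~` (a i%:Z @^-1` U n) `|` [set x | a i%:Z x = id x]).

Let measurable_locally_free L n : measurable (locally_free L n).
Proof.
apply: measurableI => //; apply: fin_bigcap_measurable; first exact: finite_II.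
move=> i _; apply: measurableU.
  by apply: measurableC; exact: measurable_preimage.
exact: (measurable_equalizer mU sepU1).
Qed.

Let locally_freeT L x : exists n, locally_free L n x.
Proof.
have [n Ux nU] := sepU x L (fun i => a i%:Z x).
exists n; split=> // i /= iL; have [->|xi] := pselect (a i%:Z x = x).
  by right.
by left; apply: nU.
Qed.

(** The points at distance at most [L] from [D] along their orbit. *)
Let near L (D : set Y) : set Y :=
  \bigcup_(k in [set k | (k <= L.*2)%N]) (a (k%:Z - L%:Z) @^-1` D).

(** A greedy choice of markers: go through the sets [locally_free L n] and keep
    the points that are not close to a marker kept before. *)
Fixpoint marker L n : set Y :=
  if n is n'.+1 then
    marker L n' `|` (locally_free L n' `\` near L (marker L n'))
  else set0.

Lemma measurable_marker L n : measurable (marker L n).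
Proof.
elim: n => //= n IHn; apply: measurableU => //; apply: measurableD => //.
apply: bigcup_measurable => k _; exact: measurable_preimage.
Qed.

(** Two markers of the same orbit that are less than [L] steps apart are equal. *)
Lemma marker_discrete L n x i : (i < L)%N ->
  marker L n x -> marker L n (a i%:Z x) -> a i%:Z x = x.
Proof.
move=> iL; elim: n => //= n IHn [Dx|[Ax nDx]] [Dy|[Ay nDy]].
- exact: IHn.
- case: nDy; exists (L - i)%N => /=; first by lia.
  by rewrite -aD (_ : _ + _ = 0) ?a0//; lia.
- case: nDx; exists (L + i)%N => /=; first by lia.
  by rewrite (_ : _ - _ = i%:Z)//; lia.
- by have [_ /(_ i iL)[]] := Ax => //; have [] := Ay.
Qed.

(** Every point of the sets already treated is close to a marker. *)
Lemma marker_cover L n m x : (m < n)%N -> locally_free L m x ->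
  near L (marker L n) x.
Proof.
move=> + Ax; elim: n => // n IHn; rewrite ltnS leq_eqVlt => /orP[/eqP mn|mn].
  rewrite {}mn in Ax *; have [[k kL Dk]|nD] := pselect (near L (marker L n) x).
    by exists k => //; left.
  exists L => /=; first by lia.
  by right; rewrite subrr a0.
by have [k kL Dk] := IHn mn; exists k => //; left.
Qed.

(** From every point off a set [Z] of small measure, the orbit meets [D] in
    bounded time in both directions, and a point of [D] off [Z] is its own first
    return to [D]. The second property holds for the markers of period less than
    [L], and the other markers have [L] pairwise disjoint
    translates, one of which has small measure; [D] is the corresponding
    translate of the set of markers. *)
Lemma exists_marker (nu : {finite_measure set Y -> \bar R}) (e : R) : 0 < e ->
  exists (D Z : set Y) (W : nat),
    [/\ measurable D, measurable Z, (nu Z < e%:E)%E &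
    forall x, ~ Z x ->
    [/\ exists2 i : nat, (i <= W)%N & D (a i%:Z x),
        exists2 k : nat, (k <= W)%N & D (a (- k.+1%:Z) x) &
        D x -> forall k : nat, D (a (- k.+1%:Z) x) ->
          (forall j : nat, (j < k)%N -> ~ D (a (- j.+1%:Z) x)) ->
          a (- k.+1%:Z) x = x]].
Proof.
move=> e0.
have [L L0 nuL] : exists2 L, (0 < L)%N & (nu setT < (L%:R * (e / 2))%:E)%E.
  (* large enough that [L] disjoint sets of mass [e / 2] cannot fit *)
  exists (Num.bound (fine (nu setT) / (e / 2))).+1 => //.
  rewrite -[nu setT]fineK ?fin_num_measure// lte_fin -ltr_pdivrMr; last lra.
  apply: le_lt_trans (ler_norm _) _; apply: lt_le_trans (archi_boundP _) _.
    by rewrite normr_ge0.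
  rewrite ger0_norm ?ler_nat//.
  by rewrite divr_ge0 ?fine_ge0//; lra.
have [N1 nuN1] := finite_measure_tail nu
  (B := fun m => a L.*2%:Z @^-1` locally_free L m)
  (fun m => measurable_preimage (ma _) (measurable_locally_free L m))
  (e := e / 4) ltac:(lra).
have [N2 nuN2] := finite_measure_tail nu
  (B := fun m => a (- L.*2%:Z) @^-1` locally_free L m)
  (fun m => measurable_preimage (ma _) (measurable_locally_free L m))
  (e := e / 4) ltac:(lra).
set Z1 := (X in nu X) in nuN1; set Z2 := (X in nu X) in nuN2.
pose N := maxn N1 N2; pose E := marker L N.
(* the markers that are not periodic with period less than [L] *)
pose F := E `&` \bigcap_(q in [set q | (q.+1 < L)%N]) ~` [set x | a q.+1%:Z x = id x].
have mF : measurable F.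
  apply: measurableI; first exact: measurable_marker.
  apply: fin_bigcap_measurable.
    apply: sub_finite_set (finite_II L) => q /=; lia.
  by move=> q _; apply: measurableC; exact: (measurable_equalizer mU sepU1).
have [c cL nuc] : exists2 c, (c < L)%N &
    (nu (a (- c%:Z) @^-1` F) < (e / 2)%:E)%E.
  apply: (finite_measure_pigeonhole (nu := nu)
    (A := fun c => a (- c%:Z) @^-1` F)) nuL.
    by move=> n; exact: measurable_preimage.
  move=> i j x /andP[ij jL] /= [Ei _] [Ej nEj].
  have ijE : a (- i%:Z) x = a (j - i)%N%:Z (a (- j%:Z) x).
    by rewrite -aD; congr a; lia.
  have := nEj (j - i).-1; rewrite prednK ?subn_gt0//; apply => /=; first by lia.
  by apply: (marker_discrete (n := N) (L := L)); rewrite -?ijE//; lia.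
have mZ1 : measurable Z1.
  by apply: measurableD; apply: bigcup_measurable => m _;
    exact: measurable_preimage.
have mZ2 : measurable Z2.
  by apply: measurableD; apply: bigcup_measurable => m _;
    exact: measurable_preimage.
have mZ3 : measurable (a (- c%:Z) @^-1` F) by exact: measurable_preimage.
exists (a (- c%:Z) @^-1` E), (Z1 `|` Z2 `|` a (- c%:Z) @^-1` F), L.*2.*2; split.
- by apply: measurable_preimage => //; exact: measurable_marker.
- by apply: measurableU => //; exact: measurableU.
- rewrite (_ : e = e / 4 + e / 4 + e / 2); last by lra.
  apply: finite_measure_setU_lt => //; first exact: measurableU.
  exact: finite_measure_setU_lt.
move=> x nZ; split.
- have [m mN Am] : exists2 m, (m < N1)%N & locally_free L m (a L.*2%:Z x).
    apply: contrapT => nA; apply: nZ; left; left; split.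
      by have [m Am] := locally_freeT L (a L.*2%:Z x); exists m.
    by move=> [m mN Am]; apply: nA; exists m.
  have [k /= kL Ek] := @marker_cover L N m _ (leq_trans mN (leq_maxl _ _)) Am.
  (* [a L.*2] overshoots by [L], so that the marker found lies ahead *)
  exists (k + L + c)%N; first by lia.
  by rewrite /= -aD; move: Ek; rewrite -aD; congr (E (a _ x)); lia.
- have [m mN Am] : exists2 m, (m < N2)%N & locally_free L m (a (- L.*2%:Z) x).
    apply: contrapT => nA; apply: nZ; left; right; split.
      by have [m Am] := locally_freeT L (a (- L.*2%:Z) x); exists m.
    by move=> [m mN Am]; apply: nA; exists m.
  have [k /= kL Ek] := @marker_cover L N m _ (leq_trans mN (leq_maxr _ _)) Am.
  exists (L.*2 + L - k - c).-1; first by lia.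
  by rewrite /= -aD; move: Ek; rewrite -aD; congr (E (a _ x)); lia.
- move=> /= Ex k Ek mink.
  (* the marker [a (- c) x] is not in [F], hence [x] has a period [q.+1 < L] *)
  have [q /= qL qx] : exists2 q, (q.+1 < L)%N & a q.+1%:Z (a (- c%:Z) x) = a (- c%:Z) x.
    apply: contrapT => nq; apply: nZ; right; split=> // q /= qL qx.
    by apply: nq; exists q.
  have qx' : a (- q.+1%:Z) x = x.
    have xE : a q.+1%:Z x = x.
      have := congr1 (a c%:Z) qx; rewrite -!aD subrr a0 => {2}<-.
      by congr a; lia.
    by rewrite -{1}xE -aD addNr a0.
  have kq : (k <= q)%N.
    by rewrite leqNgt; apply/negP => /mink; apply; rewrite qx'.
  pose y := a (- k.+1%:Z) x.
  have yE : a k.+1%:Z (a (- c%:Z) y) = a (- c%:Z) x.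
    by rewrite /y -!aD; congr a; lia.
  have : a k.+1%:Z (a (- c%:Z) y) = a (- c%:Z) y.
    have kL : (k.+1 < L)%N by lia.
    by apply: (marker_discrete (n := N) kL) => //; rewrite yE.
  rewrite yE => /(congr1 (a c%:Z)); rewrite -!(aD c%:Z) subrr !a0.
  by move=> /esym.
Qed.

End markers.

(** * Hops along an action of the integers *)

Section hops.
Context {Y : Type} (b : int -> Y -> Y).
Hypothesis b0 : forall x, b 0 x = x.
Hypothesis bD : forall i j x, b (i + j) x = b i (b j x).

(** The self-map that moves [x] by [n x] steps along the action [b]. *)
Definition hop (n : Y -> int) (x : Y) : Y := b (n x) x.

(** The total displacement of [m] successive hops from [x]. That it vanishes
    forces the orbit of [x] under [hop n] to close up after [m] hops; when [x] is
    periodic under [b] the converse can fail, and it is the vanishing of this sum,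
    a clopen condition for continuous [n], that is used below. *)
Definition hop_sum (n : Y -> int) (m : nat) (x : Y) : int :=
  \sum_(i < m) n (iter i (hop n) x).

Variable n : Y -> int.

Lemma hop_sumD p q x :
  hop_sum n (p + q) x = hop_sum n p x + hop_sum n q (iter p (hop n) x).
Proof.
rewrite /hop_sum big_split_ord/=; congr +%R; apply: eq_bigr => i _.
by rewrite addnC iterD.
Qed.

Lemma hop_sumS m x :
  hop_sum n m.+1 x = hop_sum n m x + n (iter m (hop n) x).
Proof. by rewrite /hop_sum big_ord_recr. Qed.

Lemma iter_hop m x : iter m (hop n) x = b (hop_sum n m x) x.
Proof.
elim: m => [|m IHm]; first by rewrite /hop_sum big_ord0 b0.
by rewrite hop_sumS addrC bD -IHm.
Qed.

Lemma hop_sum0_iter m x : hop_sum n m x = 0 -> iter m (hop n) x = x.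
Proof. by rewrite iter_hop => ->. Qed.

Lemma hop_sum0_mul m k x : hop_sum n m x = 0 -> hop_sum n (k * m) x = 0.
Proof.
move=> m0; elim: k => [|k IHk]; first by rewrite /hop_sum big_ord0.
by rewrite mulSn hop_sumD m0 add0r hop_sum0_iter.
Qed.

Lemma hop_sum_shift m k x : iter m (hop n) x = x ->
  hop_sum n m (iter k (hop n) x) = hop_sum n m x.
Proof.
move=> mx; have := hop_sumD m k x; rewrite mx addnC hop_sumD.
by rewrite [RHS]addrC => /addrI.
Qed.

End hops.

(** * Cutting the orbits into finite cycles *)

Section cutting.
Context d (Y : measurableType d) (R : realType).
(** The orbits of the action [a] lie inside those of the action [b]: the
    generator of [a] is the hop of [b] by [kappa]. *)
Variables (a b : int -> Y -> Y) (U : nat -> set Y) (kappa : Y -> int).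
Hypothesis a0 : forall x, a 0 x = x.
Hypothesis aD : forall i j x, a (i + j) x = a i (a j x).
Hypothesis b0 : forall x, b 0 x = x.
Hypothesis bD : forall i j x, b (i + j) x = b i (b j x).
Hypothesis ma : forall i, measurable_fun setT (a i).
Hypothesis mU : forall n, measurable (U n).
Hypothesis sepU : forall x n (g : nat -> Y), exists2 m, U m x &
  forall i, (i < n)%N -> g i <> x -> ~ U m (g i).
Hypothesis mkappa : measurable_fibers kappa.
Hypothesis kappaE : forall x, a 1 x = b (kappa x) x.

(** Going back along [a] from [x] until the first point whose predecessor is in
    [D], but at most [w] steps: the displacement, measured in [b], from the point
    reached to [x]. *)
Fixpoint height (D : set Y) (w : nat) (x : Y) : int :=
  if w is w'.+1 then
    if `[< D (a (- 1) x) >] then 0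
    else kappa (a (- 1) x) + height D w' (a (- 1) x)
  else 0.

Lemma measurable_height D w : measurable D -> measurable_fibers (height D w).
Proof.
move=> mD; elim: w => [|w IHw] /=; first exact: measurable_fibers_cst.
apply: measurable_fibers_if; [exact: measurable_preimage|exact: measurable_fibers_cst|].
apply: measurable_fibers_op.
  exact: (measurable_fibers_comp (f := a (-1)) (g := kappa)).
exact: (measurable_fibers_comp (f := a (-1)) (g := height D w)).
Qed.

(** A tower: [y] starts a segment of the orbit, and the next point of [D] is the
    top [a h y]. *)
Section tower.
Variables (D : set Y) (y : Y) (h : nat).
Hypothesis Dy : D (a (- 1) y).
Hypothesis nD : forall j, (j < h)%N -> ~ D (a j%:Z y).

Let base_sum j : int := \sum_(i < j) kappa (a i%:Z y).

Lemma base_sumP j : b (base_sum j) y = a j%:Z y.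
Proof.
elim: j => [|j IHj]; first by rewrite /base_sum big_ord0 b0 a0.
rewrite /base_sum big_ord_recr/= addrC bD IHj -kappaE -aD.
by congr a; lia.
Qed.

Lemma height_tower j w : (j <= h)%N -> (j <= w)%N ->
  height D w (a j%:Z y) = base_sum j.
Proof.
elim: j w => [|j IHj] [|w] //= jh jw; rewrite ?/base_sum ?big_ord0 //.
  by rewrite a0 asboolT.
have E : a (- 1) (a j.+1%:Z y) = a j%:Z y by rewrite -aD; congr a; lia.
rewrite E asboolF; last exact: nD.
by rewrite IHj ?big_ord_recr 1?addrC//; lia.
Qed.

Variable w : nat.
Hypothesis hw : (h <= w)%N.
Hypothesis Dh : D (a h%:Z y).

(** Inside the tower hop as [a] does; from the top return to the base, undoing
    the total displacement. *)
Let n x : int := if `[< D x >] then - height D w x else kappa x.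

Lemma iter_hop_tower j : (j <= h)%N -> iter j (hop b n) y = a j%:Z y.
Proof.
elim: j => [|j IHj] jh; first by rewrite a0.
rewrite iterS IHj; last by lia.
rewrite /hop /n asboolF; last exact: nD.
by rewrite -kappaE -aD; congr a; lia.
Qed.

Lemma hop_tower_top : hop b n (a h%:Z y) = y.
Proof.
rewrite /hop /n asboolT// height_tower// -base_sumP -bD addNr b0//.
Qed.

Lemma hop_sum_tower : hop_sum b n h.+1 y = 0.
Proof.
rewrite hop_sumS iter_hop_tower// /n asboolT// height_tower//.
apply/eqP; rewrite subr_eq0; apply/eqP; apply: eq_bigr => i _.
rewrite iter_hop_tower; last by rewrite ltnW.
by rewrite asboolF//; apply: nD.
Qed.

End tower.

(** Off a set of small measure, the generator of [a] coincides with a hop of [b]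
    whose orbit from the point is a cycle of length dividing [M] with zero total
    displacement. Nothing is claimed for the hop at the exceptional points, where
    it need not even be injective. *)
Lemma exists_cut (nu : {finite_measure set Y -> \bar R}) (e : R) : 0 < e ->
  exists (n : Y -> int) (Z : set Y) (M : nat),
    [/\ measurable_fibers n, measurable Z, (nu Z < e%:E)%E, (0 < M)%N &
    forall x, ~ Z x -> hop b n x = a 1 x /\ hop_sum b n M x = 0].
Proof.
move=> e0.
have [D [Z [W [mD mZ nuZ ZP]]]] := exists_marker a0 aD ma mU sepU nu e0.
pose n x : int := if `[< D x >] then - height D W.*2 x else kappa x.
have mn : measurable_fibers n.
  apply: measurable_fibers_if => // c.
  have := measurable_fibersP [set - c] (measurable_height W.*2 mD).
  congr (measurable _); apply/seteqP; split=> x /= h.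
    by rewrite h opprK.
  by rewrite -h opprK.
(* a common multiple of all the cycle lengths *)
exists n, Z, (W.*2.+1)`!; split=> //; first exact: fact_gt0.
move=> x /ZP[exi exk ret].
have exi' : exists i, `[< (i <= W)%N /\ D (a i%:Z x) >].
  by have [i iW Di] := exi; exists i; apply/asboolP.
have exk' : exists k, `[< (k <= W)%N /\ D (a (- k.+1%:Z) x) >].
  by have [k kW Dk] := exk; exists k; apply/asboolP.
case: (ex_minnP exi') => i /asboolP[iW Di] imin.
case: (ex_minnP exk') => k /asboolP[kW Dk] kmin.
have nDi j : (j < i)%N -> ~ D (a j%:Z x).
  move=> ji Dj; suff : (i <= j)%N by lia.
  by apply: imin; apply/asboolP; split=> //; lia.
have nDk j : (j < k)%N -> ~ D (a (- j.+1%:Z) x).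
  move=> jk Dj; suff : (k <= j)%N by lia.
  by apply: kmin; apply/asboolP; split=> //; lia.
pose y := a (- k%:Z) x.
have Dy : D (a (- 1) y) by move: Dk; rewrite /y -aD; congr (D (a _ x)); lia.
have nDy j : (j < k + i)%N -> ~ D (a j%:Z y).
  move=> jh; rewrite /y -aD; have [kj|jk] := leqP k j.
    have := @nDi (j - k)%N; rewrite (_ : _%:Z = j%:Z - k%:Z); last by lia.
    by apply; lia.
  have := @nDk (k - j).-1; rewrite (_ : - _ = j%:Z - k%:Z); last by lia.
  by apply; lia.
have Dh : D (a (k + i)%N%:Z y).
  by move: Di; rewrite /y -aD; congr (D (a _ x)); lia.
have hW : (k + i <= W.*2)%N by lia.
have xE : iter k (hop b n) y = x.
  rewrite (iter_hop_tower nDy)//; last by lia.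
  by rewrite /y -aD subrr a0.
split; last first.
  have /divnK <- : ((k + i).+1 %| (W.*2.+1)`!)%N by apply: dvdn_fact; lia.
  apply: hop_sum0_mul => //.
  have s0 := hop_sum_tower Dy nDy hW Dh.
  by rewrite -xE (hop_sum_shift _ (hop_sum0_iter b0 bD s0)).
have [Dx|nDx] := pselect (D x); last by rewrite /hop /n asboolF// -kappaE.
(* [x] is then the top of its tower, and by the choice of [D] the orbit closes
   up there by itself *)
have i0 : i = 0%N.
  apply/eqP; rewrite -leqn0; apply: imin; apply/asboolP.
  by rewrite a0.
have := hop_tower_top Dy nDy hW Dh; rewrite -/n.
rewrite {1}/y -aD (_ : _ + _ = 0) ?a0; last by lia.
move=> ->; have /(congr1 (a 1)) := ret Dx k Dk nDk.
by rewrite -aD => <-; congr (a _ x); lia.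
Qed.

End cutting.

(** * Clopen approximation of Borel data *)

Section borel_sets.
Context (X : ptopologicalType).

Lemma open_borel (A : set X) : open A -> measurable (A : set (borel X)).
Proof. by move=> oA; apply: sub_sigma_algebra. Qed.

Lemma continuous_borel (f : X -> X) : continuous f ->
  measurable_fun setT (f : borel X -> borel X).
Proof.
move=> cf; apply: (@measurability _ _ (borel X) (borel X) setT f (@open X)) => //.
move=> _ [A oA <-].
by rewrite setTI; apply: open_borel; move/continuousP: cf; apply.
Qed.

End borel_sets.

Section open_fibers.
Context {X : topologicalType}.

(** A locally constant function, that is, a continuous function into the discrete
    space [C]. *)
Definition open_fibers (C : Type) (f : X -> C) :=
  forall c, open (f @^-1` [set c]).

Lemma open_preimage_glue (C Z : Type) (f : X -> C) (F : C -> X -> Z)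
    (B : set Z) :
  open_fibers f -> (forall c, open (F c @^-1` B)) ->
  open ((fun x => F (f x) x) @^-1` B).
Proof.
move=> of_ oF; rewrite preimage_glue; apply: bigcup_open => c _.
exact: openI.
Qed.

Lemma open_fibersP (C : Type) (f : X -> C) (B : set C) :
  open_fibers f -> open (f @^-1` B).
Proof.
move=> of_; apply: (open_preimage_glue (F := fun c _ => c)) => // c.
have [Bc|nBc] := pselect (B c).
  by rewrite (_ : _ @^-1` _ = setT); [exact: openT|apply/seteqP; split].
by rewrite (_ : _ @^-1` _ = set0); [exact: open0|apply/seteqP; split].
Qed.

Lemma open_fibers_cst (C : eqType) (c : C) : open_fibers (fun=> c).
Proof.
move=> c'; have [->|cc'] := eqVneq c c'.
  by rewrite (_ : _ @^-1` _ = setT); [exact: openT|apply/seteqP; split].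
rewrite (_ : _ @^-1` _ = set0); first exact: open0.
by apply/seteqP; split=> // x /= h; rewrite h eqxx in cc'.
Qed.

Lemma open_fibers_op (C : Type) (op : C -> C -> C) (f g : X -> C) :
  open_fibers f -> open_fibers g -> open_fibers (fun x => op (f x) (g x)).
Proof.
move=> of_ og c.
apply: (open_preimage_glue (F := fun v x => op v (g x))) => // v.
exact: (open_fibersP [set w | op v w = c]).
Qed.

Lemma open_fibers_if (D : set X) (C : Type) (g h : X -> C) :
  clopen D -> open_fibers g -> open_fibers h ->
  open_fibers (fun x => if `[< D x >] then g x else h x).
Proof.
move=> [oD cD] og oh c.
rewrite (_ : _ @^-1` _ =
  (D `&` g @^-1` [set c]) `|` (~` D `&` h @^-1` [set c])).
  by apply: openU; apply: openI => //; exact: closed_openC.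
apply/seteqP; split=> x /=.
  by case: asboolP => Dx; [left|right].
by case: asboolP => Dx; case=> -[].
Qed.

Lemma open_fibers_clopen (C : Type) (f : X -> C) (B : set C) :
  open_fibers f -> clopen (f @^-1` B).
Proof.
move=> of_; split; first exact: open_fibersP.
rewrite -[X in closed X]setCK; apply: open_closedC.
exact: (open_fibersP (~` B)).
Qed.

Lemma open_fibers_comp (f : X -> X) (C : Type) (g : X -> C) :
  continuous f -> open_fibers g -> open_fibers (g \o f).
Proof.
by move=> cf og c; rewrite comp_preimage; move/continuousP: cf; apply.
Qed.

Lemma continuous_glue (C : Type) (f : X -> C) (F : C -> X -> X) :
  open_fibers f -> (forall c, continuous (F c)) ->
  continuous (fun x => F (f x) x).
Proof.
move=> of_ cF; apply/continuousP => A oA; apply: open_preimage_glue => // c.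
by move/continuousP: (cF c); apply.
Qed.

Lemma continuous_iter (f : X -> X) n : continuous f -> continuous (iter n f).
Proof.
move=> cf; elim: n => [|n IHn] x; first exact: cvg_id.
by apply: (continuous_comp (f := iter n f) (g := f)); [exact: IHn|exact: cf].
Qed.

End open_fibers.

Section clopen_approximation.
Context {R : realType} {X : pseudoPMetricType R}.
Hypothesis cX : cantor_like X.

(** A compact pseudometric space has only countably many clopen sets. *)
Lemma exists_clopen_sequence : exists V : nat -> set X,
  (forall n, clopen (V n)) /\ (forall A, clopen A -> exists n, V n = A).
Proof.
have [_ cptX _ _] := cX.
pose V := unsquash (clopen_surj cptX).
exists V; split=> [n|A cA]; first exact: funS.
by have [n _ VA] := @surj _ _ _ _ V _ cA; exists n.
Qed.

Lemma clopen_separation (x : X) n (g : nat -> X) : exists A : set X,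
  [/\ clopen A, A x & forall i, (i < n)%N -> g i <> x -> ~ A (g i)].
Proof.
have [_ _ _ zX] := cX.
elim: n => [|n [A [cA Ax nA]]]; first by exists setT; split=> //; exact: clopenT.
have [gx|gx] := pselect (g n = x).
  exists A; split=> // i; rewrite ltnS leq_eqVlt => /orP[/eqP -> //|]; exact: nA.
have [|B [cB Bx nB]] := zX x (g n); first by apply/eqP => /esym.
exists (A `&` B); split=> //; first exact: clopenI.
move=> i; rewrite ltnS leq_eqVlt => /orP[/eqP -> _ []//|iN ix [Ai _]].
exact: nA ix Ai.
Qed.

Lemma exists_separating_sequence : exists V : nat -> set (borel X),
  (forall n, measurable (V n)) /\
  forall x n (g : nat -> X), exists2 m, V m x &
    forall i, (i < n)%N -> g i <> x -> ~ V m (g i).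
Proof.
have [V [cV Vsurj]] := exists_clopen_sequence.
exists V; split=> [n|x n g]; first by apply: open_borel; have [] := cV n.
have [A [cA Ax nA]] := clopen_separation x n g.
by have [m VA] := Vsurj _ cA; exists m; rewrite VA.
Qed.

Variable nu : {finite_measure set (borel X) -> \bar R}.

(** The sets that clopen sets approximate in measure. They form a sigma-algebra,
    and contain the open sets because these are countable unions of clopen
    sets. *)
Let approximable (E : set (borel X)) :=
  measurable E /\ forall e, 0 < e -> exists2 C : set X, clopen C &
    (nu ((E `\` C) `|` (C `\` E)) < e%:E)%E.

Let clopen_borel (C : set X) : clopen C -> measurable (C : set (borel X)).
Proof. by move=> [oC _]; exact: open_borel. Qed.

Let approximableC E : approximable E -> approximable (~` E).
Proof.
move=> [mE aE]; split=> [|e /aE[C cC nuC]]; first exact: measurableC.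
exists (~` C); first exact: clopenC.
suff -> : (~` E `\` ~` C) `|` (~` C `\` ~` E) = (E `\` C) `|` (C `\` E) by [].
by rewrite !setDE !setCK (setIC (~` E)) (setIC (~` C)) setUC.
Qed.

Let approximable_bigcup (F : nat -> set (borel X)) :
  (forall n, approximable (F n)) -> approximable (\bigcup_n F n).
Proof.
move=> aF.
have mF n : measurable (F n) by have [] := aF n.
split=> [|e e0]; first exact: bigcupT_measurable.
have e2 : 0 < e / 2 by lra.
have [N nuN] := finite_measure_tail nu mF e2.
have eN : 0 < e / 2 / N.+1%:R by rewrite divr_gt0.
pose C n := s2val (cid2 ((aF n).2 _ eN)).
have cC n : clopen (C n) by rewrite /C; case: cid2.
have nuC n : (nu ((F n `\` C n) `|` (C n `\` F n)) < (e / 2 / N.+1%:R)%:E)%E.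
  by rewrite /C; case: cid2.
have mC n : measurable (C n : set (borel X)) by exact: clopen_borel.
have mFC n : measurable ((F n `\` C n) `|` (C n `\` F n) : set (borel X)).
  by apply: measurableU; exact: measurableD.
exists (\bigcup_(m in [set m | (m < N)%N]) C m).
  split; first by apply: bigcup_open => n _; have [] := cC n.
  by apply: closed_bigcup => [|n _]; [exact: finite_II|have [] := cC n].
rewrite [e]splitr; apply: le_lt_trans; last first.
  apply: finite_measure_setU_lt nuN
    (finite_measure_bigcup_lt (n := N) mFC e2 (fun n _ => nuC n)).
    by apply: measurableD; exact: bigcup_measurable.
  exact: bigcup_measurable.
apply: le_measure; rewrite ?inE.
- by apply: measurableU; apply: measurableD; exact: bigcup_measurable.
- apply: measurableU; last exact: bigcup_measurable.
  by apply: measurableD; exact: bigcup_measurable.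
move=> x [[[n _ Fn] nC]|[[n nN Cn] nF]].
  have [[k kN Fk]|nFN] := pselect ((\bigcup_(m in [set m | (m < N)%N]) F m) x).
    by right; exists k => //; left; split=> // Ck; apply: nC; exists k.
  by left; split=> //; exists n.
by right; exists n => //; right; split=> // Fn; apply: nF; exists n.
Qed.

Lemma clopen_approximation (E : set (borel X)) (e : R) :
  measurable E -> 0 < e ->
  exists2 C : set X, clopen C & (nu ((E `\` C) `|` (C `\` E)) < e%:E)%E.
Proof.
move=> mE e0; suff [_] : approximable E by apply.
move: E mE {e e0}; apply: smallest_sub.
  split.
  - split=> // e e0; exists set0; first exact: clopen0.
    by rewrite !setD0 setU0 measure0 lte_fin.
  - by move=> A aA; rewrite setTD; exact: approximableC.
  - by move=> F aF; exact: approximable_bigcup.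
move=> A oA.
have [V [cV Vsurj]] := exists_clopen_sequence.
have -> : A = \bigcup_n (if `[< V n `<=` A >] then V n else set0).
  have [_ cptX hX zX] := cX.
  apply/seteqP; split=> [x Ax|x [n _]]; last by case: asboolP => // VA /VA.
  have Anbhs : nbhs (x : X) A by exact: open_nbhs_nbhs.
  have [W [Wx cW] WA] := @zero_dimensional_cvg X x hX zX cptX _ Anbhs.
  have [n VW] := Vsurj _ cW; exists n => //.
  by rewrite asboolT VW.
apply: approximable_bigcup => n.
case: asboolP => _.
  split=> [|e e0]; first exact: clopen_borel.
  by exists (V n) => //; rewrite setDv setU0 measure0 lte_fin.
split=> // e e0; exists set0; first exact: clopen0.
by rewrite setD0 setU0 measure0 lte_fin.
Qed.

(** A Borel integer-valued function agrees with a continuous one off a set of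
    small measure. *)
Lemma open_fibers_approximation (n : borel X -> int) (e : R) :
  measurable_fibers n -> 0 < e ->
  exists2 m : X -> int, open_fibers m &
    measurable ([set x | m x <> n x] : set (borel X)) /\
    (nu [set x | m x <> n x] < e%:E)%E.
Proof.
move=> mn e0; have e2 : 0 < e / 2 by lra.
pose E v : set (borel X) := n @^-1` [set c | pickle c = v].
have mE v : measurable (E v) by exact: measurable_fibersP.
have [N nuN] := finite_measure_tail nu mE e2.
have eN : 0 < e / 2 / N.+1%:R by rewrite divr_gt0.
pose C v := s2val (cid2 (clopen_approximation (mE v) eN)).
have cC v : clopen (C v) by rewrite /C; case: cid2.
have nuC v : (nu ((E v `\` C v) `|` (C v `\` E v)) < (e / 2 / N.+1%:R)%:E)%E.
  by rewrite /C; case: cid2.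
have mEC v : measurable ((E v `\` C v) `|` (C v `\` E v) : set (borel X)).
  by apply: measurableU; apply: measurableD => //; exact: clopen_borel.
(* the largest index [v < w] such that [x] lies in [C v] gives the value *)
pose fix m (w : nat) (x : X) {struct w} : int := if w is w'.+1 then
  if `[< C w' x >] then odflt 0 (unpickle w') else m w' x else 0.
have om w : open_fibers (m w).
  elim: w => [|w IHw] /=; first exact: open_fibers_cst.
  by apply: open_fibers_if => //; exact: open_fibers_cst.
have mm : measurable_fibers (m N : borel X -> int).
  by move=> c; exact: (open_borel (om N c)).
have mne : measurable ([set x | m N x <> n x] : set (borel X)).
  have := measurable_fibersP [set v | v <> 0]
    (measurable_fibers_op (fun u v => u - v) mm mn).
  congr (measurable _); apply/seteqP; split=> x /= h; apply: contra_not h.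
    by move=> ->; rewrite subrr.
  by move/eqP; rewrite subr_eq0 => /eqP.
exists (m N) => //; split=> //.
rewrite [e]splitr; apply: le_lt_trans; last first.
  apply: finite_measure_setU_lt nuN
    (finite_measure_bigcup_lt (n := N) mEC e2 (fun v _ => nuC v)).
    by apply: measurableD; exact: bigcup_measurable.
  exact: bigcup_measurable.
apply: le_measure; rewrite ?inE//.
  apply: measurableU; last exact: bigcup_measurable.
  by apply: measurableD; exact: bigcup_measurable.
move=> x /= mx; apply: contrapT => /not_orP[nE nC]; apply: mx.
have nN : (pickle (n x) < N)%N.
  rewrite ltnNge; apply/negP => Nn; apply: nE; split.
    by exists (pickle (n x)).
  by move=> [v /= vN Ev]; move: Nn; rewrite Ev leqNgt vN.
have CE v : (v < N)%N -> C v x <-> E v x.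
  move=> vN; split=> [Cv|Ev]; apply: contrapT => h; apply: nC; exists v => //.
    by right.
  by left.
elim: {-2}N (leqnn N) nN => // w IHw wN; rewrite ltnS leq_eqVlt => nw /=.
case: asboolP => [/CE -/(_ wN) <-|nCw]; first by rewrite pickleK.
move: nw => /orP[/eqP nw|]; first by case: nCw; apply/CE.
by apply: IHw; exact: ltnW.
Qed.

End clopen_approximation.

(** * Periodic elements of the topological full group *)

Section aut_powers.
Context {R : realType} {X : pseudoPMetricType R}.
Implicit Types S T : borel_aut X.

Lemma aut_pow0 T x : aut_pow T 0 x = x.
Proof. by []. Qed.

Lemma aut_pow_succ T i x : aut_pow T (1 + i) x = T (aut_pow T i x).
Proof.
case: i => [i|[|i]]; first by [].
  by rewrite /= aut_invK.
rewrite (_ : 1 + _ = Negz i); last by lia.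
by rewrite /= aut_invK.
Qed.

Lemma aut_pow_pred T i x : aut_pow T (- 1 + i) x = aut_inv T (aut_pow T i x).
Proof.
have := aut_pow_succ T (- 1 + i) x; rewrite addrA subrr add0r => ->.
by rewrite aut_funK.
Qed.

Lemma aut_powD T i j x : aut_pow T (i + j) x = aut_pow T i (aut_pow T j x).
Proof.
elim/int_rec: i => [|i IHi|i IHi]; first by rewrite add0r.
  rewrite (_ : i.+1%:Z = 1 + i%:Z); last by lia.
  by rewrite -addrA !aut_pow_succ IHi.
rewrite (_ : - i.+1%:Z = - 1 + - i%:Z); last by lia.
by rewrite -addrA !aut_pow_pred IHi.
Qed.

Lemma continuous_aut_pow T i : homeo T -> continuous (aut_pow T i).
Proof. by move=> [cT cT']; case: i => i; exact: continuous_iter. Qed.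

Lemma full_groupB_refl T : full_groupB T T.
Proof. by move=> x y. Qed.

Lemma measurable_aut_pow T i : homeo T ->
  measurable_fun setT (aut_pow T i : borel X -> borel X).
Proof. by move=> hT; apply: continuous_borel; exact: continuous_aut_pow. Qed.

Lemma full_groupB_cocycle (cX : cantor_like X) T S : homeo T ->
  full_groupB T S -> exists2 k : borel X -> int,
    measurable_fibers k & forall x, S x = aut_pow T (k x) x.
Proof.
move=> hT TS; have [U [mU sepU]] := exists_separating_sequence cX.
apply: (measurable_choice (P := fun i => [set x : borel X | S x = aut_pow T i x])).
  move=> i; apply: (measurable_equalizer mU (separating_sequence_points sepU)).
    exact: measurable_aut.
  exact: measurable_aut_pow.
by move=> x; have [|i _ iE] := TS x (S x); [exists 1|exists i; rewrite /= iE].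
Qed.

(** The inverse of an element of the full group of a homeomorphism is Borel,
    being piecewise a power of this homeomorphism; no theorem on injective images
    of Borel sets is needed. *)
Lemma measurable_full_groupB_inv (cX : cantor_like X) T S :
  homeo T -> full_groupB T S ->
  measurable_fun setT (aut_inv S : borel X -> borel X).
Proof.
move=> hT TS; have [U [mU sepU]] := exists_separating_sequence cX.
have [|x|k mk kE] := measurable_choice
    (P := fun i => [set x : borel X | S (aut_pow T i x) = id x]).
- move=> i; apply: (measurable_equalizer mU (separating_sequence_points sepU)).
    exact: (measurableT_comp (measurable_aut S) (measurable_aut_pow i hT)).
  exact: measurable_id.
- have [|i _ iE] := TS x (aut_inv S x); first by exists (- 1).
  by exists i; rewrite /= iE aut_invK.
rewrite (_ : aut_inv S = fun x => aut_pow T (k x) x).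
  by apply: measurable_fun_glue => // i; exact: measurable_aut_pow.
by apply/funext => x; rewrite -[RHS](aut_funK S) kE.
Qed.

(** Hop by [m] on the clopen set where the total displacement of [M] hops is
    zero, and fix the other points. This set is invariant under the hop, and [M]
    hops are the identity on it, so the resulting map is bijective with no
    assumption on [m] besides continuity. *)
Lemma exists_periodic_full_group T (m : X -> int) (M : nat) :
  homeo T -> open_fibers m -> (0 < M)%N ->
  exists P : borel_aut X, [/\ per0 P, top_full_group T P &
    forall x, hop_sum (aut_pow T) m M x = 0 -> P x = hop (aut_pow T) m x].
Proof.
move=> hT om M0; pose b := aut_pow T.
have b0 x : b 0 x = x by [].
have bD := aut_powD T; rewrite -/b in bD.
have chop n : open_fibers n -> continuous (hop b n).
  by move=> on; apply: continuous_glue => // i; exact: continuous_aut_pow.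
have osum k : open_fibers (hop_sum b m k).
  elim: k => [|k IHk].
    rewrite (_ : hop_sum b m 0 = fun=> 0); first exact: open_fibers_cst.
    by apply/funext => x; rewrite /hop_sum big_ord0.
  rewrite (_ : hop_sum b m k.+1 =
    fun x => hop_sum b m k x + (m \o iter k (hop b m)) x); last first.
    by apply/funext => x; rewrite hop_sumS.
  apply: open_fibers_op => //; apply: open_fibers_comp => //.
  by apply: continuous_iter; exact: chop.
pose G : set X := hop_sum b m M @^-1` [set 0].
have cG : clopen G by exact: open_fibers_clopen.
pose n x := if `[< G x >] then m x else 0.
have on : open_fibers n.
  by apply: open_fibers_if => //; exact: open_fibers_cst.
pose p := hop b n.
have pE x : G x -> p x = hop b m x by move=> Gx; rewrite /p /hop /n asboolT.
have Ghop x : G x -> G (hop b m x).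
  move=> Gx; rewrite /G /=.
  by rewrite (hop_sum_shift 1%N (hop_sum0_iter b0 bD Gx)).
have itp x : G x -> forall k, iter k p x = iter k (hop b m) x /\ G (iter k p x).
  move=> Gx; elim=> [//|k [IHk Gk]]; rewrite iterS pE//; split.
    by rewrite IHk.
  exact: Ghop.
have pM x : iter M p x = x.
  have [Gx|nGx] := pselect (G x).
    by have [-> _] := itp x Gx M; exact: hop_sum0_iter.
  by apply: iter_fix; rewrite /p /hop /n asboolF.
have cp : continuous p by exact: chop.
have pK : cancel p (iter M.-1 p) by move=> x; rewrite -iterSr prednK.
have Kp : cancel (iter M.-1 p) p by move=> x; rewrite -iterS prednK.
pose P := Aut pK Kp (continuous_borel cp).
have hP : homeo P by split => //=; exact: continuous_iter.
have orbP k x : aut_orbit T x (iter k p x).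
  by exists (hop_sum b n k x) => //; rewrite (iter_hop b0 bD).
exists P; split.
- by split=> //; exists M.
- split.
    split=> // x _ [[k|k] _ <-]; first exact: orbP.
    by rewrite /aut_pow -iterM; exact: orbP.
  exists n => //; apply/continuousP => A _; exact: (open_fibersP A).
- by move=> x Gx; rewrite /= pE.
Qed.

End aut_powers.

(** * Density of the periodic homeomorphisms *)

Section periodic_approximation.
Context {R : realType} {X : pseudoPMetricType R}.
Hypothesis cX : cantor_like X.

Lemma periodic_approximation (T S : borel_aut X) : homeo T -> full_groupB T S ->
  forall (p : nat) (mu : 'I_p -> probability (borel X) R) (eps : R), 0 < eps ->
  exists P : borel_aut X,
    [/\ per0 P, top_full_group T P & aut_nbhs S mu eps P].
Proof.
move=> hT TS p mu e e0.
have e2 : 0 < e / 2 by lra.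
have [U [mU sepU]] := exists_separating_sequence cX.
have [kappa mkappa kappaE] := full_groupB_cocycle cX hT TS.
have mS i : measurable_fun setT (aut_pow S i : borel X -> borel X).
  case: i => i; apply: measurable_fun_iter; first exact: measurable_aut.
  exact: measurable_full_groupB_inv TS.
have [nu nuE] := finite_measure_sum (fun i => mu i : {finite_measure set _ -> \bar R}).
have mu_le i A : (mu i A <= nu A)%E.
  by rewrite nuE (bigD1 i)//= leeDl// sume_ge0.
have [n [Z [M [mn mZ nuZ M0 ZP]]]] := @exists_cut _ (borel X) R
  (aut_pow S) (aut_pow T) U kappa (aut_pow0 S) (aut_powD S)
  (aut_pow0 T) (aut_powD T) mS mU sepU mkappa kappaE nu _ e2.
pose f := hop (aut_pow T) n.
have mf : measurable_fun setT (f : borel X -> borel X).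
  by apply: measurable_fun_glue => // i; exact: measurable_aut_pow.
have push j : exists nuj : {finite_measure set (borel X) -> \bar R},
    forall A, nuj A = nu (iter j f @^-1` A).
  by apply: finite_measure_pushforward; exact: measurable_fun_iter.
pose nuj j := projT1 (cid (push j)).
have nujE j A : nuj j A = nu (iter j f @^-1` A) by rewrite /nuj; case: cid.
have [nu' nu'E] := finite_measure_sum (fun j : 'I_M => nuj j).
have eM : 0 < e / 2 / M.+1%:R by rewrite divr_gt0.
have [m om [mB nuB]] := open_fibers_approximation cX nu' mn eM.
set B := [set x | m x <> n x] in mB nuB.
have [P [perP TP PE]] := exists_periodic_full_group hT om M0.
exists P; split=> // i; apply: le_lt_trans (mu_le i _) _.
(* [P] agrees with [S] at [x] unless [x] is in the exceptional set [Z] or one of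
   the first [M] points of its orbit under [f] is in the set [B] where [m]
   differs from [n] *)
pose B_ j : set (borel X) := iter j f @^-1` B.
have mB_ j : measurable (B_ j).
  by apply: measurable_preimage => //; exact: measurable_fun_iter.
rewrite [e]splitr; apply: le_lt_trans; last first.
  apply: finite_measure_setU_lt nuZ
    (finite_measure_bigcup_lt (n := M) mB_ e2 _) => //.
    exact: bigcup_measurable.
  move=> j jM; apply: le_lt_trans nuB.
  rewrite nu'E (bigD1 (Ordinal jM))//= nujE leeDl// sume_ge0//.
apply: le_measure; rewrite ?inE.
- exact: (measurable_diff_set cX P S).
- by apply: (measurableU _ _ mZ); apply: bigcup_measurable => j _; exact: mB_.
move=> x /= PSx; apply: contrapT => /not_orP[/ZP[fx sumx] nB]; apply: PSx.
have nm j : (j < M)%N -> m (iter j f x) = n (iter j f x).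
  by move=> jM; apply: contrapT => nmj; apply: nB; exists j.
have itE j : (j <= M)%N -> iter j (hop (aut_pow T) m) x = iter j f x.
  elim: j => [|j IHj] jM; first by [].
  by rewrite !iterS (IHj (ltnW jM)) {1}/hop (nm _ jM).
have sumE : hop_sum (aut_pow T) m M x = 0.
  rewrite -sumx; apply: eq_bigr => -[j jM] _ /=.
  by rewrite (itE _ (ltnW jM)) (nm _ jM).
by rewrite (PE _ sumE) /hop (nm 0%N M0); exact: fx.
Qed.

Lemma dense_per0 : dense [set P : @homeo R X | per0 (val P)].
Proof.
move=> O [S OS] [B oB BO].
have hS : homeo (val S) by exact: set_valP.
have BS : B (val S) by move: OS; rewrite -BO.
have [_ basisB] := aut_base_basis cX.
have Bnbhs : nbhs (val S) B by exact: open_nbhs_nbhs.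
have [U [[T [p [mu [e [e0 UE]]]]] US] UB] := basisB (val S) _ Bnbhs.
rewrite UE in US UB.
have [e' e'0 US'] := aut_nbhs_open cX US.
have [P [perP _ PS]] := periodic_approximation hS (full_groupB_refl (T := val S)) mu e'0.
have hP : homeo P by case: perP.
exists (exist _ P (mem_set hP)); split=> //.
by rewrite -BO; apply: UB; exact: US'.
Qed.

End periodic_approximation.

Theorem theorem2p1 (R : realType) (X : pseudoPMetricType R)
    (cX : cantor_like X) :
  dense [set P : @homeo R X | per0 (val P)] /\
  (forall T : borel_aut X, homeo T ->
    forall S : borel_aut X, full_groupB T S ->
    forall (p : nat) (mu : 'I_p -> probability (borel X) R) (eps : R),
      0 < eps ->
    exists P : borel_aut X, [/\ per0 P, top_full_group T P & aut_nbhs S mu eps P]).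
Proof.
split; first exact: dense_per0.
by move=> T hT S TS p mu eps; exact: periodic_approximation.
Qed.
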